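(* Let $\{a_n\}_{n\ge1}$ be a sequence of positive real numbers such that $\lim_{n\to\infty}na_n$ exists, is finite and nonzero, let $r=\{r_n\}_{n\ge1}$ be a bounded sequence of strictly positive real numbers, and let $s$ be an $s$-number sequence. Then: (i) $\chi_{c_0(r)}^{(s)}$ is an operator ideal if $\{a_n\}\in c_0(r)$; (ii) $\chi_{c_0(r)}^{(s)}$ is a closed operator ideal if $\{na_n\}\in c_0(r)$.
   Context: $c_0(r)=\{\{x_k\}\in\mathbb{C}^{\mathbb{N}}:\lim_k r_kx_k=0\}$, $\mathbb{N}=\{1,2,\dots\}$. $\mathcal{B}$ is the class of all bounded linear operators between arbitrary Banach spaces, with components $\mathcal{B}(X,Y)$; $X'$ is the dual of $X$; for $x'\in X'$, $y\in Y$, $x'\otimes y:X\to Y$ is $(x'\otimes y)(x)=x'(x)y$. An $s$-number sequence is a map $s:\mathcal{B}\to\mathbb{R}^{\mathbb{N}}$ assigning to each $\phi\in\mathcal{B}$ a non-negative sequence $\{s_n(\phi)\}$ with: (1) $\|\phi\|=s_1(\phi)\ge s_2(\phi)\ge\cdots\ge0$; (2) $s_{m+n-1}(\phi+\psi)\le s_m(\phi)+s_n(\psi)$ for $\phi,\psi\in\mathcal{B}(X,Y)$; (3) $s_n(\zeta\phi\eta)\le\|\zeta\|s_n(\phi)\|\eta\|$ for $\eta\in\mathcal{B}(X_0,X)$, $\phi\in\mathcal{B}(X,Y)$, $\zeta\in\mathcal{B}(Y,Y_0)$; (4) $s_n(\phi)=0$ if $\operatorname{rank}(\phi)<n$; (5)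 $s_n(I:\ell_2^{(n)}\to\ell_2^{(n)})=1$, where $I$ is the identity operator on the $n$-dimensional Hilbert space $\ell_2^{(n)}$. The class $\chi_{c_0(r)}^{(s)}$ has components, for Banach spaces $X,Y$, $$\chi_{c_0(r)}^{(s)}(X,Y)=\Big\{\phi\in\mathcal{B}(X,Y):\lim_{i\to\infty}\Big(a_i\sum_{j=1}^is_j(\phi)\Big)r_i=0\Big\}.$$ A class $\mathcal{A}=\bigcup_{X,Y}\mathcal{A}(X,Y)$ with $\mathcal{A}(X,Y)\subseteq\mathcal{B}(X,Y)$ is an operator ideal if, for all Banach spaces: $x'\otimes y\in\mathcal{A}(X,Y)$ for $x'\in X'$, $y\in Y$; $\phi+\psi\in\mathcal{A}(X,Y)$ for $\phi,\psi\in\mathcal{A}(X,Y)$; and $\zeta\phi\eta\in\mathcal{A}(X_0,Y_0)$ for $\eta\in\mathcal{B}(X_0,X)$, $\phi\in\mathcal{A}(X,Y)$, $\zeta\in\mathcal{B}(Y,Y_0)$. It is closed if every component $\mathcal{A}(X,Y)$ is a closed linear subset of $\mathcal{B}(X,Y)$ (in the operator norm). *)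

(* Defs.v *)
From HB Require Import structures.
From mathcomp Require Import all_boot all_order all_algebra complex.
From mathcomp Require Import all_classical all_reals all_analysis.

Set Implicit Arguments.
Unset Strict Implicit.
Unset Printing Implicit Defensive.

Import Order.TTheory GRing.Theory Num.Theory.
Import numFieldNormedType.Exports.

Local Open Scope classical_set_scope.
Local Open Scope complex_scope.
Local Open Scope ring_scope.

(* In a [normedModType R[i]] the norm [`|x|] takes its values in [R[i]];
   [nrm x] is the same number, seen as an element of [R]. *)
Definition nrm (R : realType) (V : normedModType R[i]) (x : V) : R :=
  complex.Re `|x|.

Section nrm_theory.
Context {R : realType} {V : normedModType R[i]}.
Implicit Types x y : V.

Lemma nrmE x : `|x| = (nrm x)%:C.
Proof. by rewrite /nrm RRe_real// normr_real. Qed.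

Lemma nrm_ge0 x : 0 <= nrm x.
Proof. by have := normr_ge0 x; rewrite nrmE lecR. Qed.

Lemma ler_nrmD x y : nrm (x + y) <= nrm x + nrm y.
Proof. by have := ler_normD x y; rewrite !nrmE -rmorphD/= lecR. Qed.

Lemma nrmZ (k : R[i]) x : nrm (k *: x) = complex.Re `|k| * nrm x.
Proof.
have := normrZ k x; rewrite !nrmE.
have -> : `|k| = (complex.Re `|k|)%:C by rewrite RRe_real// normr_real.
by rewrite -rmorphM /= => -[].
Qed.

Lemma nrm0 : nrm (0 : V) = 0.
Proof. by rewrite /nrm normr0. Qed.

Lemma nrm_eq0 x : nrm x = 0 -> x = 0.
Proof. by move=> x0; apply: normr0_eq0; rewrite nrmE x0. Qed.

End nrm_theory.

Definition bounded_linear (R : realType) (X Y : normedModType R[i]) :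
    {pred X -> Y} :=
  mem [set f : X -> Y | linear f /\
                        exists M : R, forall x, nrm (f x) <= M * nrm x].

(* The component $\mathcal{B}(X,Y)$. *)
Record bop (R : realType) (X Y : normedModType R[i]) := Bop {
  bop_fun :> X -> Y ;
  bop_subproof : bop_fun \in @bounded_linear R X Y }.

Section bop_lmod.
Context {R : realType} {X Y : normedModType R[i]}.

HB.instance Definition _ := [isSub for @bop_fun R X Y].
HB.instance Definition _ := [Choice of bop X Y by <:].

Lemma bounded_linear_submod_closed : submod_closed (@bounded_linear R X Y).
Proof.
split.
  rewrite inE; split; first by move=> k x y; rewrite /= scaler0 addr0.
  by exists 0 => x; rewrite mul0r nrm0.
move=> k f g; rewrite !inE => -[lf [M fM]] [lg [N gN]]; split.
  move=> c x y; rewrite /= !fctE lf lg.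
  by rewrite !scalerDr !scalerA mulrC addrACA.
exists (complex.Re `|k| * M + N) => x.
rewrite mulrDl (le_trans (ler_nrmD _ _))// lerD// nrmZ -mulrA ler_wpM2l//.
by have := normr_ge0 k; rewrite lecE => /andP[].
Qed.

HB.instance Definition _ := GRing.isSubmodClosed.Build R[i] (X -> Y)
  (@bounded_linear R X Y) bounded_linear_submod_closed.
HB.instance Definition _ := [SubChoice_isSubLmodule of bop X Y by <:].

End bop_lmod.

Section bop_linear.
Context {R : realType} {X Y : normedModType R[i]} (f : bop X Y).

Let bop_is_linear : linear f.
Proof. by have := bop_subproof f; rewrite inE => -[]. Qed.

HB.instance Definition _ := GRing.isLinear.Build R[i] X Y *:%R f bop_is_linear.

Lemma bop_bounded : exists M : R, forall x, nrm (f x) <= M * nrm x.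
Proof. by have := bop_subproof f; rewrite inE => -[]. Qed.

End bop_linear.

Definition opnorm (R : realType) (X Y : normedModType R[i]) (f : bop X Y) : R :=
  sup [set nrm (f x) | x in [set x : X | nrm x <= 1]].

Section bop_normed.
Context {R : realType} {X Y : normedModType R[i]}.
Implicit Types f g : bop X Y.

Lemma opnorm_has_sup f :
  has_sup [set nrm (f x) | x in [set x : X | nrm x <= 1]].
Proof.
split; first by exists (nrm (f 0)), 0 => //=; rewrite nrm0.
have [M fM] := bop_bounded f; exists `|M| => _ [x /= x1 <-].
rewrite (le_trans (fM x))// (le_trans (ler_wpM2r (nrm_ge0 x) (ler_norm M)))//.
by rewrite ler_piMr.
Qed.

Lemma opnorm_le f (M : R) :
  (forall x, nrm x <= 1 -> nrm (f x) <= M) -> opnorm f <= M.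
Proof.
move=> fM; apply: ge_sup; first by case: (opnorm_has_sup f).
by move=> _ [x /= x1 <-]; exact: fM.
Qed.

Lemma opnorm_ge f x : nrm x <= 1 -> nrm (f x) <= opnorm f.
Proof.
by move=> x1; apply: ub_le_sup; [case: (opnorm_has_sup f)|exists x].
Qed.

Lemma opnorm_ge0 f : 0 <= opnorm f.
Proof. by apply: le_trans (opnorm_ge f (x := 0) _); rewrite ?nrm_ge0// nrm0. Qed.

Lemma nrm_opnorm f x : nrm (f x) <= opnorm f * nrm x.
Proof.
have [->|x0] := eqVneq x 0; first by rewrite linear0 !nrm0 mulr0.
have nx0 : 0 < nrm x.
  by rewrite lt_neqAle nrm_ge0 andbT eq_sym; apply: contra_neq x0 => /nrm_eq0.
have Re_inv : complex.Re `|((nrm x)^-1)%:C : R[i]| = (nrm x)^-1.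
  by rewrite ger0_norm// lecR invr_ge0 ltW.
have := @opnorm_ge f (((nrm x)^-1)%:C *: x).
rewrite linearZ/= !nrmZ Re_inv mulVf ?gt_eqF// => /(_ (lexx _)).
by rewrite ler_pdivrMl// mulrC.
Qed.

Let bop_norm f : R[i] := (opnorm f)%:C.

Let bop_normD f g : bop_norm (f + g) <= bop_norm f + bop_norm g.
Proof.
rewrite /bop_norm -rmorphD/= lecR; apply: opnorm_le => x x1.
by rewrite (le_trans (ler_nrmD _ _))// lerD// opnorm_ge.
Qed.

Let bop_normZ (k : R[i]) f : bop_norm (k *: f) = `|k| * bop_norm f.
Proof.
have [c c0 kc] : exists2 c : R, 0 <= c & `|k| = c%:C.
  exists (complex.Re `|k|); last by rewrite RRe_real// normr_real.
  by have := normr_ge0 k; rewrite lecE => /andP[].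
have Zc (V : normedModType R[i]) (x : V) : nrm (k *: x) = c * nrm x.
  by rewrite nrmZ kc.
rewrite /bop_norm kc -rmorphM; congr (_ %:C).
move: c0; rewrite le_eqVlt => /predU1P[c0|c0].
  rewrite -c0 mul0r; apply/eqP; rewrite eq_le opnorm_ge0 andbT.
  by apply: opnorm_le => x _; rewrite Zc -c0 mul0r.
apply/eqP; rewrite eq_le; apply/andP; split.
  by apply: opnorm_le => x x1; rewrite Zc ler_pM2l// opnorm_ge.
rewrite -ler_pdivlMl//; apply: opnorm_le => x x1.
by rewrite ler_pdivlMl// -Zc; exact: (@opnorm_ge (k *: f)).
Qed.

Let bop_norm_eq0 f : bop_norm f = 0 -> f = 0.
Proof.
move=> -[f0]; apply/val_inj/funext => x; apply: nrm_eq0; apply/eqP.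
by rewrite eq_le nrm_ge0 andbT (le_trans (nrm_opnorm f x))// f0 mul0r.
Qed.

HB.instance Definition _ := Lmodule_isNormed.Build R[i] (bop X Y)
  bop_normD bop_normZ bop_norm_eq0.

Lemma bop_nrmE f : nrm f = opnorm f.
Proof. by []. Qed.

End bop_normed.

Section bop_operations.
Context {R : realType}.

Lemma bop_id_subproof (X : normedModType R[i]) :
  id \in @bounded_linear R X X.
Proof. by rewrite inE; split=> //; exists 1 => x; rewrite mul1r. Qed.

Definition bop_id (X : normedModType R[i]) : bop X X := Bop (bop_id_subproof X).

Lemma bop_comp_subproof (X Y Z : normedModType R[i])
  (g : bop Y Z) (f : bop X Y) : g \o f \in @bounded_linear R X Z.
Proof.
rewrite inE; split; first by move=> k x y; rewrite /= !linearP.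
exists (opnorm g * opnorm f) => x; rewrite -mulrA.
by rewrite (le_trans (nrm_opnorm _ _))// ler_wpM2l ?opnorm_ge0// nrm_opnorm.
Qed.

Definition bop_comp (X Y Z : normedModType R[i]) (g : bop Y Z) (f : bop X Y) :
  bop X Z := Bop (bop_comp_subproof g f).

Lemma bop_tensor_subproof (X Y : normedModType R[i])
  (x' : bop X R[i]^o) (y : Y) :
  (fun x => x' x *: y) \in @bounded_linear R X Y.
Proof.
rewrite inE; split.
  by move=> k u v; rewrite linearP scalerDl scalerA.
exists (opnorm x' * nrm y) => x; rewrite nrmZ mulrAC.
by rewrite ler_wpM2r ?nrm_ge0//; exact: (nrm_opnorm x' x).
Qed.

(* $x' \otimes y$, for $x'$ in the dual of $X$. *)
Definition bop_tensor (X Y : normedModType R[i])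
    (x' : bop X R[i]^o) (y : Y) : bop X Y :=
  Bop (bop_tensor_subproof x' y).

End bop_operations.

Lemma normc_le_ReIm (R : realType) (z : R[i]) :
  `|z| <= (`|complex.Re z| + `|complex.Im z|)%:C.
Proof.
rewrite normc_def lecR -[leRHS]ger0_norm ?addr_ge0// -sqrtr_sqr ler_wsqrtr//.
by rewrite sqrrD !real_normK ?num_real// addrAC lerDl mulrn_wge0// mulr_ge0.
Qed.

(* $\ell_2^{(n)}$. The Euclidean norm is put on a type distinct from
   ['rV[R[i]]_n], which already carries the sup norm. *)
Definition l2 (R : realType) (n : nat) : Type := 'rV[R[i]]_n.

Section l2.
Context {R : realType} {n : nat}.

HB.instance Definition _ := GRing.Lmodule.copy (l2 R n) 'rV[R[i]]_n.

Definition l2_norm (v : l2 R n) : R[i] :=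
  sqrtC (\sum_(i < n) `|(v : 'rV_n) ord0 i| ^+ 2).

Let l2_normE (v : l2 R n) : l2_norm v = sqrtC (dotmx v v).
Proof.
rewrite /l2_norm dotmxE mxE; congr sqrtC; apply: eq_bigr => i _.
by rewrite normCK !mxE.
Qed.

Let l2_normD (u v : l2 R n) : l2_norm (u + v) <= l2_norm u + l2_norm v.
Proof. by rewrite !l2_normE; have [] := triangle_lerif (@dotmx R[i] n) u v. Qed.

Let l2_normZ (k : R[i]) (v : l2 R n) : l2_norm (k *: v) = `|k| * l2_norm v.
Proof.
rewrite !l2_normE dnormZ sqrtCM ?nnegrE ?exprn_ge0 ?dnorm_ge0//.
by rewrite sqrCK.
Qed.

Let l2_norm_eq0 (v : l2 R n) : l2_norm v = 0 -> v = 0.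
Proof. by move/eqP; rewrite l2_normE sqrt_dnorm_eq0 => /eqP. Qed.

HB.instance Definition _ := Lmodule_isNormed.Build R[i] (l2 R n)
  l2_normD l2_normZ l2_norm_eq0.

Lemma l2_coord_le (v : l2 R n) (i : 'I_n) : `|(v : 'rV_n) ord0 i| <= `|v|.
Proof.
rewrite -[leLHS]sqrCK// ler_sqrtC ?nnegrE ?exprn_ge0 ?sumr_ge0//.
by rewrite (bigD1 i)//= lerDl sumr_ge0.
Qed.

Lemma l2_le_coord (v : l2 R n) : `|v| <= \sum_(i < n) `|(v : 'rV_n) ord0 i|.
Proof.
have s0 : 0 <= \sum_(i < n) `|(v : 'rV_n) ord0 i| by rewrite sumr_ge0.
rewrite -[leRHS]sqrCK// ler_sqrtC ?nnegrE ?exprn_ge0 ?sumr_ge0//.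
suff [] : \sum_(i < n) `|(v : 'rV_n) ord0 i| ^+ 2 <=
    (\sum_(i < n) `|(v : 'rV_n) ord0 i|) ^+ 2 /\
    0 <= \sum_(i < n) `|(v : 'rV_n) ord0 i| by [].
apply: (big_ind2 (fun x y : R[i] => x <= y ^+ 2 /\ 0 <= y)) => //.
move=> x y z t [xy y0] [zt t0]; split; last exact: addr_ge0.
by rewrite sqrrD addrAC ler_wpDr ?lerD// mulrn_wge0// mulr_ge0.
Qed.

Lemma l2_complete (F : set_system (l2 R n)) :
  ProperFilter F -> cauchy F -> cvg F.
Proof.
move=> FF /cauchyP Fc.
have key (h : R[i] -> R) : (forall x y, h (x - y) = h x - h y) ->
    (forall x, `|h x|%:C <= `|x|) ->
    forall i : 'I_n, exists p : R, forall e : R, 0 < e ->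
      F [set v : l2 R n | `|p - h ((v : 'rV_n) ord0 i)| < e].
  move=> hB hle i.
  have : cvg ((fun v : l2 R n => h ((v : 'rV_n) ord0 i)) @ F).
    apply: R_complete; apply/cauchyP => e e0.
    have e0' : 0 < e%:C by rewrite ltcR.
    have [v Fv] := Fc _ e0'; exists (h ((v : 'rV_n) ord0 i)).
    rewrite /nbhs/= /fmap; apply: (@filterS _ F _ _ _ _ Fv) => u.
    rewrite -!ball_normE /= => uv.
    rewrite -ltcR -hB (le_lt_trans (hle _))// (le_lt_trans _ uv)//.
    by have := l2_coord_le (v - u) i; rewrite !mxE.
  move=> /cvg_ex[p /cvgrPdist_lt hp]; exists p => e e0; exact: hp.
have [p Fp] := choice (key (@complex.Re R) (fun x y => raddfB _ x y)
  (@normc_ge_Re R)).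
have imle (x : R[i]) : `|complex.Im x|%:C <= `|x|.
  by rewrite normc_def lecR -sqrtr_sqr ler_wsqrtr// lerDr sqr_ge0.
have [q Fq] := choice (key (@complex.Im R) (fun x y => raddfB _ x y) imle).
apply/cvg_ex; exists ((\row_i (p i +i* q i)) : l2 R n).
apply/cvgrPdist_lt => e e0.
have [d de] : exists d : R, e = d%:C by apply/complex_realP/gtr0_real.
rewrite {}de ltcR in e0 *.
pose d' := d / (2 * n.+1%:R).
have d'0 : 0 < d' by rewrite divr_gt0// mulr_gt0.
near=> v.
rewrite (le_lt_trans (l2_le_coord _))//.
apply: (@le_lt_trans _ _ (\sum_(i < n) (d' + d')%:C)); last first.
  rewrite sumr_const card_ord -rmorphMn/= ltcR -mulr2n -mulrnA.
  rewrite -[ltLHS]mulr_natr /d' mulrAC ltr_pdivrMr ?mulr_gt0// ltr_pM2l//.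
  by rewrite -natrM ltr_nat ltn_mul2l/=.
apply: ler_sum => i _; apply: le_trans (normc_le_ReIm _) _.
rewrite !mxE lecR lerD//.
  by rewrite ltW// raddfB; move: (i); near: v; apply: filter_forall => j; exact: Fp.
by rewrite ltW// raddfB; move: (i); near: v; apply: filter_forall => j; exact: Fq.
Unshelve. all: by end_near. Qed.

HB.instance Definition _ := Uniform_isComplete.Build (l2 R n) l2_complete.

End l2.

(* The range of [f] has dimension [m]. *)
Definition has_rank (R : realType) (X Y : normedModType R[i]) (f : bop X Y)
    (m : nat) : Prop :=
  exists v : 'I_m -> Y,
    (forall c : 'I_m -> R[i], \sum_i c i *: v i = 0 -> forall i, c i = 0) /\
    range f = [set \sum_i c i *: v i | c in [set: 'I_m -> R[i]]].

(* Sequences indexed by $\{1,2,\dots\}$ are functions on [nat] whose value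
   at [0] is irrelevant. *)
Definition op_seq_map (R : realType) : Type :=
  forall X Y : completeNormedModType R[i], bop X Y -> nat -> R.

Record is_snumber (R : realType) (s : op_seq_map R) : Prop := IsSnumber {
  snumber_norm : forall (X Y : completeNormedModType R[i]) (phi : bop X Y),
    s X Y phi 1 = opnorm phi ;
  snumber_decr : forall (X Y : completeNormedModType R[i]) (phi : bop X Y) n,
    (0 < n)%N -> s X Y phi n.+1 <= s X Y phi n ;
  snumber_ge0 : forall (X Y : completeNormedModType R[i]) (phi : bop X Y) n,
    (0 < n)%N -> 0 <= s X Y phi n ;
  snumber_add : forall (X Y : completeNormedModType R[i])
      (phi psi : bop X Y) m n, (0 < m)%N -> (0 < n)%N ->
    s X Y (phi + psi) (m + n - 1)%N <= s X Y phi m + s X Y psi n ;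
  snumber_comp : forall (X0 X Y Y0 : completeNormedModType R[i])
      (zeta : bop Y Y0) (phi : bop X Y) (eta : bop X0 X) n, (0 < n)%N ->
    s X0 Y0 (bop_comp zeta (bop_comp phi eta)) n
      <= opnorm zeta * s X Y phi n * opnorm eta ;
  snumber_rank : forall (X Y : completeNormedModType R[i]) (phi : bop X Y) m n,
    has_rank phi m -> (m < n)%N -> s X Y phi n = 0 ;
  snumber_id : forall n, (0 < n)%N ->
    s (l2 R n) (l2 R n) (bop_id (l2 R n)) n = 1 }.

Definition op_class (R : realType) : Type :=
  forall X Y : completeNormedModType R[i], set (bop X Y).

Record operator_ideal (R : realType) (A : op_class R) : Prop := OperatorIdeal {
  ideal_tensor : forall (X Y : completeNormedModType R[i])
      (x' : bop X R[i]^o) (y : Y), A X Y (bop_tensor x' y) ;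
  ideal_add : forall (X Y : completeNormedModType R[i]) (phi psi : bop X Y),
    A X Y phi -> A X Y psi -> A X Y (phi + psi) ;
  ideal_comp : forall (X0 X Y Y0 : completeNormedModType R[i])
      (zeta : bop Y Y0) (phi : bop X Y) (eta : bop X0 X),
    A X Y phi -> A X0 Y0 (bop_comp zeta (bop_comp phi eta)) }.

Record closed_operator_ideal (R : realType) (A : op_class R) : Prop :=
  ClosedOperatorIdeal {
  closed_ideal_ideal : operator_ideal A ;
  closed_ideal_0 : forall X Y : completeNormedModType R[i], A X Y 0 ;
  closed_ideal_linear : forall (X Y : completeNormedModType R[i]) (k : R[i])
      (phi psi : bop X Y), A X Y phi -> A X Y psi -> A X Y (k *: phi + psi) ;
  closed_ideal_closed : forall X Y : completeNormedModType R[i],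
    closed (A X Y) }.

Definition c0 (R : realType) (r : nat -> R) : set (nat -> R[i]) :=
  [set x | ((r k)%:C * x k : R[i]^o) @[k --> \oo] --> (0 : R[i]^o)].

(* $\chi_{c_0(r)}^{(s)}$ *)
Definition chi_c0 (R : realType) (a r : nat -> R) (s : op_seq_map R) :
    op_class R := fun X Y =>
  [set phi | (a i * (\sum_(1 <= j < i.+1) s X Y phi j)) * r i @[i --> \oo]
               --> (0 : R)].

(* Main.v *)
(** The partial sums [S_i] of the [s]-numbers satisfy
    [S_i (phi + psi) <= 2 (S_i phi + S_i psi)], because
    [s_(2k) <= s_(2k-1)] and
    [s_(2k-1) (phi + psi) <= s_k phi + s_k psi]; composing with [zeta] and [eta]
    multiplies them by at most [opnorm zeta * opnorm eta], and they are constant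
    in [i] for operators of rank at most one.
    In (ii), [S_i phi <= i * opnorm phi] makes the class contain every bounded
    operator. *)

Require Import Defs.
From mathcomp Require Import all_boot all_order all_algebra complex.
From mathcomp Require Import all_classical all_reals all_analysis.

Import Order.TTheory GRing.Theory Num.Theory.
Import numFieldNormedType.Exports.

Local Open Scope classical_set_scope.
Local Open Scope complex_scope.
Local Open Scope ring_scope.

(** Prepares the pairing of $s_{2k-1}$ with $s_{2k}$; since [k] starts at 1, the predecessor in
    [k.*2.-1] is never truncated at 0. *)
Lemma sum_double (R : zmodType) (F : nat -> R) (n : nat) :
  \sum_(1 <= j < n.*2.+1) F j = \sum_(1 <= k < n.+1) (F k.*2.-1 + F k.*2).
Proof.
elim: n => [|n IHn]; first by rewrite !big_geq.
rewrite [RHS]big_nat_recr//= -IHn doubleS big_nat_recr//= big_nat_recr//=.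
by rewrite addrA.
Qed.

(** Bridges complex null sequences and the real limit that defines [chi_c0]: the complex modulus of
    a real number is its absolute value. *)
Lemma c0_real (R : realType) (r x : nat -> R) :
  c0 r (fun n => (x n)%:C) -> r k * x k @[k --> \oo] --> (0 : R).
Proof.
move=> /cvgrPdist_lt rx0; apply/cvgrPdist_lt => e e0.
have e0' : 0 < e%:C by rewrite ltcR.
apply: filterS (rx0 _ e0') => k.
rewrite !sub0r !normrN -rmorphM /= => h.
by rewrite -ltcR; apply: le_lt_trans h; rewrite normc_def/= expr0n addr0 sqrtr_sqr.
Qed.

(** [has_rank] asks for the exact dimension, hence the case split: it is 1 when [x'] and [y] are
    both nonzero, and 0 otherwise. *)
Lemma bop_tensor_rank (R : realType) (X Y : normedModType R[i])
    (x' : bop X R[i]^o) (y : Y) :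
  exists2 m, (m < 2)%N & has_rank (bop_tensor x' y) m.
Proof.
have [[[x x'x] y0]|f0] := pselect ((exists x, x' x != 0) /\ y != 0).
  exists 1%N => //; exists (fun=> y); split.
    move=> c; rewrite big_ord1 => /eqP; rewrite scaler_eq0 (negPf y0) orbF.
    by move=> /eqP c0 i; rewrite ord1.
  apply/seteqP; split => [_ [z _ <-]|_ [c _ <-]].
    by exists (fun=> x' z) => //; rewrite big_ord1.
  (* [x'] sends this vector to [c ord0], because [x' x] is nonzero. *)
  exists ((c ord0 / x' x) *: x) => //=.
  by rewrite big_ord1 linearZ/= -[_ *: x' x]/(_ * x' x) divfK.
have fE z : bop_tensor x' y z = 0.
  apply/eqP; rewrite /= scaler_eq0; apply: contra_notT f0.
  by rewrite negb_or => /andP[x'z y0]; split => //; exists z.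
exists 0%N => //; exists (fun=> 0); split; first by move=> c _ [].
apply/seteqP; split => [_ [z _ <-]|_ [c _ <-]].
  by exists (fun=> 0) => //; rewrite big_ord0 fE.
by exists 0 => //; rewrite big_ord0 fE.
Qed.

Section snumber_sums.
Context {R : realType} {s : op_seq_map R} (s_snumber : is_snumber s).

Lemma snumber_nincr (X Y : completeNormedModType R[i]) (phi : bop X Y) m n :
  (0 < m)%N -> (m <= n)%N -> s X Y phi n <= s X Y phi m.
Proof.
move=> m0; elim: n => [|n IHn]; first by rewrite leqNgt m0.
rewrite leq_eqVlt => /predU1P[->//|mn].
apply: le_trans (IHn mn); apply: snumber_decr => //.
exact: leq_trans m0 mn.
Qed.

Lemma snumber_sum_ge0 (X Y : completeNormedModType R[i]) (phi : bop X Y) i :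
  0 <= \sum_(1 <= j < i.+1) s X Y phi j.
Proof.
by rewrite big_nat sumr_ge0// => j /andP[j0 _]; exact: snumber_ge0.
Qed.

(** Each of the [i] terms is at most the first one, which is the operator norm. *)
Lemma snumber_sum_le (X Y : completeNormedModType R[i]) (phi : bop X Y) i :
  \sum_(1 <= j < i.+1) s X Y phi j <= i%:R * opnorm phi.
Proof.
rewrite -(snumber_norm s_snumber).
rewrite (@le_trans _ _ (\sum_(1 <= j < i.+1) s X Y phi 1%N))//.
  by rewrite ler_sum_nat// => j /andP[j0 _]; exact: snumber_nincr.
by rewrite big_const_nat subn1 iter_addr_0 mulr_natl.
Qed.

(** Rank at most 1 kills every term after the first; [0 < i] ensures that the first is present. *)
Lemma snumber_sum_tensor (X Y : completeNormedModType R[i])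
    (x' : bop X R[i]^o) (y : Y) i : (0 < i)%N ->
  \sum_(1 <= j < i.+1) s X Y (bop_tensor x' y) j = opnorm (bop_tensor x' y).
Proof.
move=> i0; have [m m2 rk] := bop_tensor_rank R X Y x' y.
rewrite big_ltn// (snumber_norm s_snumber) big_nat big1 ?addr0// => j.
by move=> /andP[j1 _]; apply: (snumber_rank s_snumber rk); exact: leq_trans j1.
Qed.

Lemma snumber_sum_add (X Y : completeNormedModType R[i]) (phi psi : bop X Y) i :
  \sum_(1 <= j < i.+1) s X Y (phi + psi) j <=
    2 * (\sum_(1 <= j < i.+1) s X Y phi j + \sum_(1 <= j < i.+1) s X Y psi j).
Proof.
(* Going up to [i.*2] adds only nonnegative terms and makes the sum split into pairs. *)
apply: (@le_trans _ _ (\sum_(1 <= j < i.*2.+1) s X Y (phi + psi) j)).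
  have ii : (i.+1 <= i.*2.+1)%N by rewrite ltnS -addnn leq_addr.
  rewrite [leRHS](big_cat_nat _ (n := i.+1))//= lerDl big_nat sumr_ge0// => j.
  by move=> /andP[ij _]; apply: snumber_ge0 => //; exact: leq_ltn_trans ij.
rewrite sum_double -big_split/= mulr_sumr ler_sum_nat// => k /andP[k0 _].
(* Subadditivity with both indices equal to [k], as $2k-1 = k+k-1$. *)
have odd_le : s X Y (phi + psi) k.*2.-1 <= s X Y phi k + s X Y psi k.
  by rewrite -addnn -subn1; exact: snumber_add.
rewrite mulr_natl mulr2n lerD// (le_trans _ odd_le)//.
by apply: snumber_nincr; case: k k0 {odd_le}.
Qed.

Lemma snumber_sum_comp (X0 X Y Y0 : completeNormedModType R[i])
    (zeta : bop Y Y0) (phi : bop X Y) (eta : bop X0 X) i :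
  \sum_(1 <= j < i.+1) s X0 Y0 (bop_comp zeta (bop_comp phi eta)) j <=
    opnorm zeta * opnorm eta * \sum_(1 <= j < i.+1) s X Y phi j.
Proof.
rewrite mulr_sumr ler_sum_nat// => j /andP[j0 _].
by rewrite mulrAC; exact: snumber_comp.
Qed.

End snumber_sums.

Section chi_ideal.
Context {R : realType} {a r : nat -> R} {s : op_seq_map R}.
Hypotheses (a_gt0 : forall n : nat, (0 < n)%N -> 0 < a n)
  (r_gt0 : forall n : nat, (0 < n)%N -> 0 < r n) (s_snumber : is_snumber s).

(** Common form of all membership proofs below: squeeze between 0 and the sequence built on a
    majorant of the partial sums. *)
Lemma chi_c0_le (X Y : completeNormedModType R[i]) (phi : bop X Y)
    (u : nat -> R) :
  (forall i, (0 < i)%N -> \sum_(1 <= j < i.+1) s X Y phi j <= u i) ->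
  a i * u i * r i @[i --> \oo] --> (0 : R) -> chi_c0 a r s phi.
Proof.
move=> su u0; apply: (squeeze_cvgr _ (cvg_cst 0) u0).
(* The signs of [a] and [r] are known at positive indices only. *)
near=> i; have i0 : (0 < i)%N by near: i; exact: nbhs_infty_gt.
rewrite !mulr_ge0 ?(ltW (a_gt0 _ _)) ?(ltW (r_gt0 _ _))// ?snumber_sum_ge0//=.
by rewrite ler_pM2r ?r_gt0// ler_pM2l ?a_gt0// su.
Unshelve. all: by end_near. Qed.

Lemma chi_c0_ideal :
  c0 r (fun n => (a n)%:C) -> operator_ideal (chi_c0 a r s).
Proof.
move=> /c0_real ra0; split=> [X Y x' y|X Y phi psi hphi hpsi|].
(* The majorant is constant in [i], so $a_i r_i \to 0$ suffices. *)
- apply: (@chi_c0_le _ _ _ (fun=> opnorm (bop_tensor x' y))) => [i i0|].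
    by rewrite snumber_sum_tensor.
  have := cvgMr_tmp (b := opnorm (bop_tensor x' y)) ra0; rewrite mul0r.
  under eq_fun do rewrite -mulrA mulrC; apply.
- apply: (chi_c0_le _ _ _ _ (fun i _ => snumber_sum_add s_snumber X Y phi psi i)).
  have := cvgMl_tmp (a := 2) (cvgD hphi hpsi); rewrite addr0 mulr0.
  under eq_fun do rewrite -mulrDl -mulrDr mulrA mulrCA; apply.
- move=> X0 X Y Y0 zeta phi eta hphi.
  apply: (chi_c0_le _ _ _ _
    (fun i _ => snumber_sum_comp s_snumber X0 X Y Y0 zeta phi eta i)).
  have := cvgMl_tmp (a := opnorm zeta * opnorm eta) hphi; rewrite mulr0.
  under eq_fun do rewrite mulrA (mulrCA _ (a _)); apply.
Qed.

(** The factor [i] in the bound on the partial sums is absorbed by $i a_i r_i \to 0$. *)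
Lemma chi_c0_full (X Y : completeNormedModType R[i]) (phi : bop X Y) :
  c0 r (fun n => (n%:R * a n)%:C) -> chi_c0 a r s phi.
Proof.
move=> /c0_real rna0.
apply: (chi_c0_le _ _ _ _ (fun i _ => snumber_sum_le s_snumber X Y phi i)).
have := cvgMr_tmp (b := opnorm phi) rna0; rewrite mul0r.
under eq_fun do rewrite (mulrC _%:R) -!mulrA mulrC; apply.
Qed.

End chi_ideal.

Theorem theorem5p8 (R : realType) (a r : nat -> R) (s : op_seq_map R)
  (a_gt0 : forall n : nat, (0 < n)%N -> 0 < a n)
  (a_lim : exists l : R, l != 0 /\ n%:R * a n @[n --> \oo] --> l)
  (r_gt0 : forall n : nat, (0 < n)%N -> 0 < r n)
  (r_bounded : exists M : R, forall n : nat, (0 < n)%N -> r n <= M)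
  (s_snumber : is_snumber s) :
  (c0 r (fun n => (a n)%:C) -> operator_ideal (chi_c0 a r s)) /\
  (c0 r (fun n => (n%:R * a n)%:C) -> closed_operator_ideal (chi_c0 a r s)).
Proof.
split=> [|rna0]; first exact: chi_c0_ideal.
have full (X Y : completeNormedModType R[i]) (phi : bop X Y) :
  chi_c0 a r s phi by exact: chi_c0_full.
(* With every operator in the class, the algebraic conditions are immediate and only topological
   closedness remains. *)
split=> // X Y.
have -> : @chi_c0 R a r s X Y = setT by apply/seteqP; split.
exact: closedT.
Qed.
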